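(* For a word $w$ over $\{\mathtt{a},\mathtt{b}\}$ let $\mathrm{ext}(w)=\{\mathtt{a}w\mathtt{a},\mathtt{a}w\mathtt{b},\mathtt{b}w\mathtt{a},\mathtt{b}w\mathtt{b}\}$. Then for each $i\ge5$, the set of minimal unique substrings of $T_i$ is $\mathrm{ext}(T_{i-3})\cup\mathrm{ext}(\overline{T_{i-3}})$.
   Context: The Thue–Morse morphism is $\mu(\mathtt{a})=\mathtt{ab}$, $\mu(\mathtt{b})=\mathtt{ba}$, and $T_i=\mu^{i-1}(\mathtt{a})$ for $i\ge1$. For a binary word $w$, $\overline{w}$ is obtained by swapping $\mathtt{a}$ and $\mathtt{b}$. A minimal unique substring (MUS) of $w$ is a substring $u$ occurring exactly once in $w$, say at $[i,j]$, such that both $w[i+1..j]$ and $w[i..j-1]$ occur at least twice in $w$. *)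

(* Defs.v *)
From mathcomp Require Import all_boot.

Set Implicit Arguments.
Unset Strict Implicit.
Unset Printing Implicit Defensive.

Definition letter : Type := bool.
Definition a : letter := false.
Definition b : letter := true.

Definition word : Type := seq bool.

Definition mu_letter (c : letter) : word :=
  if c then [:: b; a] else [:: a; b].

Definition mu (w : word) : word := flatten (map mu_letter w).

(* Meaningful for i >= 1 only: T 1 = a, T 2 = ab, T 3 = abba. *)
Definition T (i : nat) : word := iter i.-1 mu [:: a].

Definition compl (w : word) : word := map negb w.

(* 0-based and half-open: factor w i j consists of the letters of w at the
   positions i, ..., j - 1, so that, in the 1-based inclusive notation,
   w[i..j] is factor w i.-1 j. *)
Definition factor (w : word) (i j : nat) : word := take (j - i) (drop i w).

Definition occurrences (u w : word) : seq nat :=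
  [seq k <- iota 0 (size w).+1 | prefix u (drop k w)].

Definition nb_occ (u w : word) : nat := size (occurrences u w).

Definition is_MUS (w u : word) : Prop :=
  exists i j : nat,
    [/\ i < j <= size w,
        u = factor w i j,
        nb_occ u w = 1,
        2 <= nb_occ (factor w i.+1 j) w
      & 2 <= nb_occ (factor w i j.-1) w].

Definition ext (w : word) : seq word :=
  [:: a :: rcons w a; a :: rcons w b; b :: rcons w a; b :: rcons w b].

(* Main.v *)
Require Import Defs.
From mathcomp Require Import all_boot.

Set Implicit Arguments.
Unset Strict Implicit.
Unset Printing Implicit Defensive.

(** The proof is by induction on [i], starting from a computation at [i = 5].
    Call a family of words a basis of [w] if its members are MUSs of [w] and
    every word occurring exactly once in [w] contains one of them; a basis is
    then exactly the set of MUSs.  If the words [c t d], with [t] in a set [C]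
    and [c], [d] arbitrary letters, form a basis of [w], then the words
    [c t d] with [t] in [mu C] form a basis of [mu w].  Indeed
    [mu (c t d) = c (~c mu(t) d) ~d]; as [t] starts with two distinct letters,
    [mu t] contains a square [ee] forcing every occurrence of [~c mu(t) d] to
    start at an odd position, so it extends to an occurrence of [mu (c t d)].
    Conversely a word [x] unique in [mu w] is [mu v] with at most one letter
    removed at each end, where [v] is unique in [w]; a [c t d] inside [v]
    yields [~c mu(t) d] inside [x]. *)

(** * Counting occurrences *)

Lemma occurrencesP (u w : word) (k : nat) :
  reflect (exists p s, w = p ++ u ++ s /\ size p = k) (k \in occurrences u w).
Proof.
rewrite mem_filter mem_iota add0n ltnS leq0n /=.
apply: (iffP andP) => [[/prefixP[s def_s] le_k]|[p [s [-> <-]]]].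
  by exists (take k w), s; rewrite -def_s cat_take_drop size_takel.
by rewrite drop_size_cat // prefix_prefix size_cat leq_addr.
Qed.

Lemma uniq_occurrences (u w : word) : uniq (occurrences u w).
Proof. by rewrite filter_uniq ?iota_uniq. Qed.

Lemma nb_occ_gt0P (u w : word) :
  reflect (exists p s, w = p ++ u ++ s) (0 < nb_occ u w).
Proof.
rewrite /nb_occ -has_predT.
apply: (iffP hasP) => [[k /occurrencesP[p [s [-> _]]] _]|[p [s ->]]].
  by exists p, s.
by exists (size p) => //; apply/occurrencesP; exists p, s.
Qed.

(** Numbers of occurrences are compared by mapping positions: by a shift for factors, by [double]
    along [mu], by [half] back. *)
Lemma leq_nb_occ (f : nat -> nat) (u w u' w' : word) :
    {in occurrences u w &, injective f} ->
    {in occurrences u w, forall k, f k \in occurrences u' w'} ->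
  nb_occ u w <= nb_occ u' w'.
Proof.
move=> inj_f sub_f; rewrite /nb_occ -(size_map f); apply: uniq_leq_size.
  by rewrite map_inj_in_uniq ?uniq_occurrences.
by move=> _ /mapP[k k_occ ->]; apply: sub_f.
Qed.

Lemma infix_nb_occ (x y w : word) : infix x y -> nb_occ y w <= nb_occ x w.
Proof.
move=> /infixP[l [r ->]]; apply: (@leq_nb_occ (addn^~ (size l))) => [k k' _ _|k].
  exact: addIn.
move=> /occurrencesP[p [s [-> <-]]]; apply/occurrencesP.
by exists (p ++ l), (r ++ s); rewrite !catA size_cat.
Qed.

(** By length, [l] is a prefix of [l'] and [r] a suffix of [r']; cancelling both leaves [y] inside
    [x]. *)
Lemma infix_cat_inner (l x r l' y r' : word) :
    l ++ x ++ r = l' ++ y ++ r' -> size l <= size l' -> size r <= size r' ->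
  infix y x.
Proof.
move=> eq_w le_l le_r; have := congr1 (take (size l)) eq_w.
rewrite take_size_cat // takel_cat // => def_l.
have def_l' : l' = l ++ drop (size l) l' by rewrite {1}def_l cat_take_drop.
move: eq_w; rewrite {1}def_l' -catA => /(congr1 (drop (size l))).
rewrite !drop_size_cat // => eq_w.
have def_r' : r' = take (size r' - size r) r' ++ r.
  have := congr1 rev eq_w; rewrite !rev_cat -!catA => /(congr1 (take (size r))).
  rewrite take_size_cat ?size_rev // takel_cat ?size_rev // take_rev.
  by move=> /(can_inj revK) {2}->; rewrite cat_take_drop.
move: eq_w; rewrite def_r' !catA => /(congr1 rev); rewrite !(rev_cat _ r).
move=> /(congr1 (drop (size r))); rewrite !drop_size_cat ?size_rev //.
by move=> /(can_inj revK) ->; rewrite -catA infix_infix.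
Qed.

(** Eliminates the positions [i], [j] of [is_MUS]; from here on only words and their numbers of
    occurrences matter. *)
Lemma is_MUS_basis (E : word -> Prop) (w u : word) :
    (forall v, E v -> [/\ 0 < size v, nb_occ v w = 1,
       2 <= nb_occ (behead v) w & 2 <= nb_occ (take (size v).-1 v) w]) ->
    (forall x, nb_occ x w = 1 -> exists2 v, E v & infix v x) ->
  is_MUS w u <-> E u.
Proof.
move=> E_MUS E_min; split=> [[i [j [/andP[lt_ij le_jw] def_u u1 ub ut]]]|Eu].
  have [v Ev /infixP[l [r def_u']]] := E_min _ u1.
  have [_ v1 _ _] := E_MUS v Ev.
  have fbE : factor w i.+1 j = behead u.
    rewrite def_u /factor subnS -add1n -drop_drop.
    by case: (drop i w) (j - i) => [|c s] [|n] //=; rewrite drop0 ?take0.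
  have ftE : factor w i j.-1 = take (size u).-1 u.
    have szu : size u = j - i.
      by rewrite def_u size_takel // size_drop leq_sub2r.
    rewrite szu def_u /factor take_takel ?leq_pred //.
    by congr take; rewrite -!subn1 subnAC.
  (* Here [u = l ++ v ++ r]. Unless [l] and [r] are both empty, [v] lies in [u] deprived of its
     first or last letter; that word occurs twice, against the uniqueness of [v]. *)
  case: l def_u' => [|c l] def_u'.
    case/lastP: r def_u' => [|r c] def_u'; first by rewrite def_u' cats0.
    move: ut; rewrite ftE def_u' /= size_cat size_rcons addnS /=.
    rewrite -rcons_cat -cats1 take_size_cat ?size_cat //.
    by move=> /leq_trans/(_ (infix_nb_occ _ (prefixW (prefix_prefix v r)))); rewrite v1.
  move: ub; rewrite fbE def_u' /=.
  by move=> /leq_trans/(_ (infix_nb_occ _ (infix_infix l v r))); rewrite v1.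
have [u_gt0 u1 ub ut] := E_MUS u Eu.
have /nb_occ_gt0P[p [s def_w]] : 0 < nb_occ u w by rewrite u1.
have fE : factor w (size p) (size p + size u) = u.
  by rewrite /factor addKn def_w drop_size_cat // take_size_cat.
exists (size p), (size p + size u); split=> //.
- by rewrite -addn1 leq_add2l u_gt0 def_w !size_cat addnA leq_addr.
- suff -> : factor w (size p).+1 (size p + size u) = behead u by [].
  rewrite /factor -add1n -drop_drop def_w drop_size_cat // add1n subnS addKn.
  by case: (u) u_gt0 => //= c u' _; rewrite drop0 take_size_cat.
suff -> : factor w (size p) (size p + size u).-1 = take (size u).-1 u by [].
rewrite /factor def_w drop_size_cat // -subn1 subnAC addKn subn1.
by rewrite takel_cat ?leq_pred.
Qed.

(** * Factors of images under the Thue-Morse morphism *)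

Lemma mu_cons c w : mu (c :: w) = c :: ~~ c :: mu w.
Proof. by case: c. Qed.

Lemma mu_cat u w : mu (u ++ w) = mu u ++ mu w.
Proof. by rewrite /mu map_cat flatten_cat. Qed.

Lemma mu_rcons w c : mu (rcons w c) = mu w ++ [:: c; ~~ c].
Proof. by rewrite -cats1 mu_cat mu_cons. Qed.

Lemma size_mu w : size (mu w) = (size w).*2.
Proof. by elim: w => //= c w IHw; rewrite mu_cons /= IHw. Qed.

Lemma mu_compl w : mu (compl w) = compl (mu w).
Proof. by elim: w => // c w IHw; rewrite [compl _]/= !mu_cons IHw. Qed.

(** A cut of [mu w] falls between two blocks, or inside the block of a letter [c]. *)
Variant mu_cat_spec (w p s : word) : Prop :=
  | MuCatEven p' s' of w = p' ++ s' & p = mu p' & s = mu s'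
  | MuCatOdd p' c s' of w = p' ++ c :: s' & p = rcons (mu p') c
                      & s = ~~ c :: mu s'.

Lemma mu_catP (w p s : word) : mu w = p ++ s -> mu_cat_spec w p s.
Proof.
elim: w p s => [|c w IHw] p s.
  by case: p s => [|//] [|//] _; apply: (@MuCatEven _ _ _ [::] [::]).
rewrite mu_cons; case: p => [|c1 p] /=.
  by move=> <-; apply: (@MuCatEven _ _ _ [::] (c :: w)); rewrite ?mu_cons.
case: p => [|c2 p] /= [<-]; first by move=> <-; apply: (@MuCatOdd _ _ _ [::] c w).
move=> <- /IHw[p' s' -> -> ->|p' d s' -> -> ->].
  by apply: (@MuCatEven _ _ _ (c :: p') s'); rewrite ?mu_cons.
by apply: (@MuCatOdd _ _ _ (c :: p') d s'); rewrite ?mu_cons.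
Qed.

Lemma mu_cat_inv (t r s : word) :
  mu s = mu t ++ r -> exists2 s', s = t ++ s' & r = mu s'.
Proof.
elim: t s => [|c t IHt] s; first by exists s.
case: s => [|d s]; rewrite !mu_cons //= => -[-> _ /IHt[s' -> ->]].
by exists s'.
Qed.

Lemma nb_occ_mu v w : nb_occ v w <= nb_occ (mu v) (mu w).
Proof.
apply: (@leq_nb_occ double) => [k k' _ _|k]; first exact: double_inj.
move=> /occurrencesP[p [s [-> <-]]]; apply/occurrencesP.
by exists (mu p), (mu s); rewrite !mu_cat size_mu.
Qed.

Lemma mu_ext c t d :
  mu (c :: rcons t d) = [:: c] ++ (~~ c :: rcons (mu t) d) ++ [:: ~~ d].
Proof. by rewrite mu_cons mu_rcons /= -cats1 -catA. Qed.

Definition alternating_start (t : word) : Prop := exists e t', t = e :: ~~ e :: t'.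

Lemma nb_occ_mu_ext c t d w : alternating_start t ->
  nb_occ (~~ c :: rcons (mu t) d) (mu w) <= nb_occ (c :: rcons t d) w.
Proof.
move=> [e [t' def_t]].
have occ_odd k : k \in occurrences (~~ c :: rcons (mu t) d) (mu w) ->
    exists2 k', k = k'.*2.+1 & k' \in occurrences (c :: rcons t d) w.
  move=> /occurrencesP[p [s [/mu_catP mu_w <-]]].
  case: mu_w => [p' s' _ _|p' c' s' -> -> ].
    (* At an even position the second block would be the square of [~~ e], but the letters of a
       block differ. *)
    rewrite def_t !mu_cons; case: s' => [|x [|y s']]; rewrite ?mu_cons //=.
    by move=> [_ _ <-]; case: (e).
  (* At an odd position the cut block is that of [c], whole blocks spell [mu t], and [d] opens the
     next block. *)
  rewrite -[rcons _ d]cats1 /= -catA => -[/negb_inj <- /esym/mu_cat_inv[[|d' s''] -> //]].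
  rewrite mu_cons => -[<- _]; exists (size p').
    by rewrite size_rcons size_mu.
  by apply/occurrencesP; exists p', s''; rewrite -cats1 /= -catA.
apply: (@leq_nb_occ half) => [k1 k2|k].
  move=> /occ_odd[k1' -> _] /occ_odd[k2' -> _].
  by rewrite -!uphalfE !uphalf_double => ->.
by move=> /occ_odd[k' -> k'_occ]; rewrite -uphalfE uphalf_double.
Qed.

(** [l] and [r] complete the blocks cut by the two ends of [x]. *)
Lemma mu_cover p x s w : mu w = p ++ x ++ s ->
  exists v l r, [/\ infix v w, mu v = l ++ x ++ r, size l <= 1 & size r <= 1].
Proof.
move=> /mu_catP mu_w.
have [p' [s1 [l [-> def_s1 le_l]]]] :
    exists p' s1 l, [/\ w = p' ++ s1, mu s1 = (l ++ x) ++ s & size l <= 1].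
  case: mu_w => [p' s' -> _ def_s|p' c s' -> _ def_s].
    by exists p', s', [::].
  by exists p', (c :: s'), [:: c]; rewrite mu_cons -def_s.
have [v s' -> def_v _|v c s' -> def_v _] := mu_catP def_s1.
  by exists v, l, [::]; rewrite cats0 infix_infix.
exists (rcons v c), l, [:: ~~ c]; split=> //.
  by rewrite -cat_rcons infix_infix.
by rewrite mu_rcons catA def_v cat_rcons.
Qed.

(** * Bases of unique substrings *)

(** [rcons t d] and [c :: t] are [c t d] without its first and its last letter. *)
Definition ext_basis (C : seq word) (w : word) : Prop :=
  (forall t c d, t \in C ->
     [/\ nb_occ (c :: rcons t d) w = 1, 2 <= nb_occ (rcons t d) w
       & 2 <= nb_occ (c :: t) w]) /\
  (forall x, nb_occ x w = 1 ->
     exists t c d, t \in C /\ infix (c :: rcons t d) x).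

Lemma ext_basis_mu C w : {in C, forall t, alternating_start t} ->
  ext_basis C w -> ext_basis (map mu C) (mu w).
Proof.
move=> altC [C_MUS C_min]; split=> [_ c d /mapP[t Ct ->]|x x1].
  (* The left letter is negated because [c mu(t) d] lies inside [mu (~c t d)]. *)
  have [ctd1 td2 ct2] := C_MUS t (~~ c) d Ct; split.
  - apply/eqP; rewrite eqn_leq; apply/andP; split.
      by rewrite -ctd1 -{1}(negbK c) nb_occ_mu_ext //; apply: altC.
    rewrite -ctd1; apply: leq_trans (nb_occ_mu _ _) _.
    by apply: infix_nb_occ; rewrite mu_ext negbK infix_infix.
  - apply: leq_trans td2 (leq_trans (nb_occ_mu _ _) _).
    by apply: infix_nb_occ; rewrite mu_rcons -cat_rcons prefixW ?prefix_prefix.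
  apply: leq_trans ct2 (leq_trans (nb_occ_mu _ _) _).
  apply: infix_nb_occ; apply/infixP; exists [:: ~~ c], [::].
  by rewrite mu_cons negbK cats0.
have /nb_occ_gt0P[p [s /mu_cover]] : 0 < nb_occ x (mu w) by rewrite x1.
move=> [v [l [r [v_w def_v le_l le_r]]]].
have v1 : nb_occ v w = 1.
  apply/eqP; rewrite eqn_leq; apply/andP; split.
    rewrite -x1; apply: leq_trans (nb_occ_mu _ _) _.
    by apply: infix_nb_occ; rewrite def_v infix_infix.
  by apply/nb_occ_gt0P/infixP.
have [t [c [d [Ct /infixP[v1' [v2' def_v']]]]]] := C_min v v1.
exists (mu t), (~~ c), d; split; first exact: map_f.
(* The letters [c] and [~~ d] around [~c mu(t) d] absorb the at most one letter that [x] lacks at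
   each end of [mu v]. *)
apply: (@infix_cat_inner l x r (mu v1' ++ [:: c]) _ (~~ d :: mu v2')).
- by rewrite -def_v def_v' !mu_cat mu_ext -!catA.
- by rewrite size_cat addn1 (leq_trans le_l).
by rewrite (leq_trans le_r).
Qed.

Lemma mem_extP (t u : word) :
  reflect (exists c d, u = c :: rcons t d) (u \in ext t).
Proof.
rewrite !inE; apply: (iffP idP) => [|[[] [[] ->]]]; rewrite ?eqxx ?orbT //.
by case/or4P=> /eqP->; do 2!eexists.
Qed.

Lemma ext_basis_MUS C w u : ext_basis C w ->
  is_MUS w u <-> exists2 t, t \in C & u \in ext t.
Proof.
move=> [C_MUS C_min].
apply: (@is_MUS_basis (fun v => exists2 t, t \in C & v \in ext t)).
  move=> _ [t Ct /mem_extP[c [d ->]]]; have [ctd1 td2 ct2] := C_MUS t c d Ct.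
  split=> //; suff -> : take (size (c :: rcons t d)).-1 (c :: rcons t d) = c :: t by [].
  by rewrite [_.-1]size_rcons -rcons_cons -cats1 take_size_cat.
move=> x /C_min[t [c [d [Ct ctd_x]]]].
by exists (c :: rcons t d) => //; exists t => //; apply/mem_extP; exists c, d.
Qed.

(** * Bases of the Thue-Morse words *)

Lemma ext_basis_T5 : ext_basis [:: T 2; compl (T 2)] (T 5).
Proof.
split=> [t c d|x x1].
  by rewrite !inE => /orP[]/eqP->; case: c; case: d; vm_compute.
pose Q y := (nb_occ y (T 5) == 1) ==>
  has (fun v => infix v y) (ext (T 2) ++ ext (compl (T 2))).
(* [T 5] has 16 letters, so starts and lengths from 0 to 16 cover all its factors. *)
have allQ : all (fun p => all (fun n => Q (take n (drop p (T 5)))) (iota 0 17))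
              (iota 0 17) by vm_compute.
have /nb_occ_gt0P[p [s def_w]] : 0 < nb_occ x (T 5) by rewrite x1.
have szT : size p + (size x + size s) = 16 by rewrite -!size_cat -def_w.
have xE : take (size x) (drop (size p) (T 5)) = x.
  by rewrite def_w drop_size_cat // take_size_cat.
have p_in : size p \in iota 0 17 by rewrite mem_iota ltnS -szT leq_addr.
have x_in : size x \in iota 0 17.
  by rewrite mem_iota ltnS -szT addnCA leq_addr.
have : Q x by rewrite -xE; apply: (allP (allP allQ _ p_in) _ x_in).
rewrite /Q x1 eqxx implyTb.
move=> /hasP[v]; rewrite mem_cat => v_ext v_x.
case/orP: v_ext => /mem_extP[c [d def_v]]; rewrite def_v in v_x.
  by exists (T 2), c, d; rewrite !inE eqxx.
by exists (compl (T 2)), c, d; rewrite !inE eqxx orbT.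
Qed.

Lemma T_alternating_start n : alternating_start (T n.+2).
Proof.
elim: n => [|n [e [t' def_t]]]; first by exists a, [::].
by exists e, (mu (~~ e :: t')); rewrite -[T _]/(mu (T n.+2)) def_t !mu_cons.
Qed.

Lemma compl_alternating_start t :
  alternating_start t -> alternating_start (compl t).
Proof. by move=> [e [t' ->]]; exists (~~ e), (compl t'). Qed.

Lemma ext_basis_T n : ext_basis [:: T n.+2; compl (T n.+2)] (T n.+4.+1).
Proof.
elim: n => [|n IHn]; first exact: ext_basis_T5.
(* [mu] commutes with [compl] and raises each index of [T] by one, so the basis keeps its form. *)
have := ext_basis_mu _ IHn; rewrite [map _ _]/= mu_compl; apply=> t.
rewrite !inE => /orP[]/eqP->; last apply: compl_alternating_start;
  exact: T_alternating_start.
Qed.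

Theorem theorem35 (i : nat) (hi : 5 <= i) (u : seq bool) :
  is_MUS (T i) u <-> u \in ext (T (i - 3)) \/ u \in ext (compl (T (i - 3))).
Proof.
have [n ->] : exists n, i = n.+4.+1 by exists (i - 5); rewrite -addn1 -addn4 -addnA subnK.
have -> : n.+4.+1 - 3 = n.+2 by rewrite !subSS subn0.
apply: iff_trans (ext_basis_MUS u (ext_basis_T n)) _; split.
  by move=> [t]; rewrite !inE => /orP[]/eqP->; [left | right].
by case=> u_ext; [exists (T n.+2) | exists (compl (T n.+2))];
  rewrite // !inE eqxx ?orbT.
Qed.
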